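(* Let $f:\mathbb{R}^n\to\mathbb{R}$ and $c:\mathbb{R}^n\to\mathbb{R}^m$ ($m\le n$) be differentiable, with $J(x)\in\mathbb{R}^{m\times n}$ the Jacobian of $c$ at $x$. Let $f_{\mathrm{low}}\in\mathbb{R}$ satisfy $f(x)\ge f_{\mathrm{low}}$ for all $x\in\mathbb{R}^n$, and let $\varepsilon_0,\varepsilon_1>0$, $\alpha>1$, $\beta_0\ge1$. Let $x_0\in\mathbb{R}^n$ satisfy $\|c(x_0)\|\le\varepsilon_0/\sqrt2$. Assume there are constants $R>\varepsilon_0$ and $\sigma_{\min}>0$ such that $$\|J(x)^\top c(x)\|\ge\sigma_{\min}\|c(x)\|\quad\text{for all } x\in\mathbb{R}^n \text{ with } \|c(x)\|\le R,$$ and assume that the sublevel set $\mathcal{L}_f(2f(x_0)-f_{\mathrm{low}})=\{x\in\mathbb{R}^n: f(x)\le 2f(x_0)-f_{\mathrm{low}}\}$ is bounded. Let $L_{f,0}\ge0$ be such that $\|\nabla f(x)\|\le L_{f,0}$ for all $x\in\mathcal{L}_f(2f(x_0)-f_{\mathrm{low}})$. Let $x_1,x_2,\dots$ be iterates generated from $x_0$ by the Quadratic Penalty Method (QPM) with penalty parameters $\beta_k=\alpha^k\beta_0$ and feasibility-aware tolerance $\tau$, and let $T\ge2$ be an integer. If $\|c(x_k)\|>\varepsilon_0$ for $k=1,\dots,T-1$, then $$\beta_{T-2}<\max\left\{\frac{L_{f,0}+\varepsilon_1}{\sigma_{\min}},\ \frac{4(f(x_0)-f_{\mathrm{low}})}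{R}\right\}\varepsilon_0^{-1}.$$
   Context: $\|\cdot\|$ is the Euclidean norm. Quadratic penalty: $Q_\beta(x)=f(x)+\frac{\beta}{2}\|c(x)\|^2$. Feasibility-aware tolerance: for some $\tau_{\mathrm{cap}}\ge\varepsilon_1$, $\tau(x)=\max\{\varepsilon_1,\min(\tau_{\mathrm{cap}},\frac{\varepsilon_1}{\varepsilon_0}\|c(x)\|)\}$. QPM: given $\varepsilon_0,\varepsilon_1>0$, $\alpha>1$, $\beta_0\ge1$, $\tau$ and $x_0$; for $k=0,1,2,\dots$: find $x_{k+1}$ such that $Q_{\beta_k}(x_{k+1})\le\min\{Q_{\beta_k}(x_k),Q_{\beta_k}(x_0)\}$ and $\|\nabla Q_{\beta_k}(x_{k+1})\|\le\tau(x_{k+1})$ (such points are assumed to be found at every iteration); if $\|c(x_{k+1})\|\le\varepsilon_0$, stop and return $x_{k+1}$; otherwise set $\beta_{k+1}=\alpha\beta_k$ and continue. *)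

(* Defs.v *)
(* Points of R^n are row vectors 'rV[R]_n.  The canonical norm `|_| of
   MathComp-Analysis on row vectors is the sup norm, so the Euclidean norm is
   defined explicitly below.  The topology, hence [differentiable] and
   [bounded_set], does not depend on this choice. *)
From HB Require Import structures.
From mathcomp Require Import all_boot all_order all_algebra.
From mathcomp Require Import all_classical all_reals all_analysis.

Set Implicit Arguments.
Unset Strict Implicit.
Unset Printing Implicit Defensive.

Import Order.TTheory GRing.Theory Num.Theory.
Import numFieldNormedType.Exports.

Local Open Scope classical_set_scope.
Local Open Scope ring_scope.

Definition enorm (R : realType) (n : nat) (u : 'rV[R]_n) : R :=
  Num.sqrt (\sum_(i < n) u 0 i ^+ 2).

Definition gradient (R : realType) (n : nat) (f : 'rV[R]_n -> R)
    (x : 'rV[R]_n) : 'rV[R]_n :=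
  \row_(i < n) 'D_(delta_mx 0 i) f x.

(* The library's [jacobian c x] acts on row vectors from the right, so it is
   the n x m transpose of the usual m x n Jacobian matrix (dc_i / dx_j). *)
Definition Jac (R : realType) (n m : nat) (c : 'rV[R]_n -> 'rV[R]_m)
    (x : 'rV[R]_n) : 'M[R]_(m, n) :=
  (jacobian c x)^T.

Definition sublevel (R : realType) (n : nat) (f : 'rV[R]_n -> R) (a : R) :
    set 'rV[R]_n :=
  [set x | f x <= a].

Definition Qpen (R : realType) (n m : nat) (f : 'rV[R]_n -> R)
    (c : 'rV[R]_n -> 'rV[R]_m) (beta : R) (x : 'rV[R]_n) : R :=
  f x + beta / 2 * enorm (c x) ^+ 2.

Definition feas_tol (R : realType) (n m : nat) (c : 'rV[R]_n -> 'rV[R]_m)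
    (eps0 eps1 taucap : R) (x : 'rV[R]_n) : R :=
  Num.max eps1 (Num.min taucap (eps1 / eps0 * enorm (c x))).

Definition penalty (R : realType) (alpha beta0 : R) (k : nat) : R :=
  alpha ^+ k * beta0.

Definition QPM_step (R : realType) (n m : nat) (f : 'rV[R]_n -> R)
    (c : 'rV[R]_n -> 'rV[R]_m) (tau : 'rV[R]_n -> R) (x0 : 'rV[R]_n)
    (beta : R) (y z : 'rV[R]_n) : Prop :=
  Qpen f c beta z <= Num.min (Qpen f c beta y) (Qpen f c beta x0) /\
  enorm (gradient (Qpen f c beta) z) <= tau z.

(* Iteration k is carried out only if the method has not stopped at one of
   x_1, ..., x_k.  A run that stops is represented by any infinite sequence
   extending it: the terms after the stopping point are unconstrained. *)
Definition QPM_iterates (R : realType) (n m : nat) (f : 'rV[R]_n -> R)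
    (c : 'rV[R]_n -> 'rV[R]_m) (eps0 alpha beta0 : R) (tau : 'rV[R]_n -> R)
    (x0 : 'rV[R]_n) (x : nat -> 'rV[R]_n) : Prop :=
  x 0%N = x0 /\
  forall k : nat,
    (forall j : nat, (1 <= j <= k)%N -> eps0 < enorm (c (x j))) ->
    QPM_step f c tau x0 (penalty alpha beta0 k) (x k) (x k.+1).

(* Main.v *)
(* Write b for the penalty parameter of the step producing z = x_(T-1), which is
   infeasible. Comparing Q_b(z) with Q_b(x_0) gives f(z) < f(x_0) and
   b |c(z)|^2 < 4 (f(x_0) - f_low). If b were at least the claimed bound, then
   |c(z)| <= r, hence b sigma |c(z)| <= |grad Q_b(z)| + |grad f(z)|
   <= (eps1 / eps0) |c(z)| + L. Since |c(z)| > eps0 this contradicts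
   b sigma eps0 >= L + eps1 as soon as L > 0. If L = 0, then f is stationary on
   its bounded sublevel set; following a line from z, f would remain constant and
   never leave that set, which is impossible unless n = 0, and then m = 0 and
   z is feasible. *)
Require Import Defs.
From HB Require Import structures.
From mathcomp Require Import all_boot all_order all_algebra.
From mathcomp Require Import all_classical all_reals all_analysis.
From mathcomp Require Import ring lra.

Import Order.TTheory GRing.Theory Num.Theory.
Import numFieldNormedType.Exports.

Local Open Scope classical_set_scope.
Local Open Scope ring_scope.

Lemma enorm_ge0 (R : realType) (n : nat) (u : 'rV[R]_n) : 0 <= enorm u.
Proof. exact: sqrtr_ge0. Qed.

Lemma sqr_enorm (R : realType) (n : nat) (u : 'rV[R]_n) :
  enorm u ^+ 2 = \sum_(i < n) u 0 i ^+ 2.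
Proof. by rewrite sqr_sqrtr// sumr_ge0// => i _; rewrite sqr_ge0. Qed.

Lemma enormZ (R : realType) (n : nat) (a : R) (u : 'rV[R]_n) :
  enorm (a *: u) = `|a| * enorm u.
Proof.
rewrite /enorm -sqrtr_sqr -sqrtrM ?sqr_ge0// mulr_sumr.
by congr Num.sqrt; apply: eq_bigr => i _; rewrite mxE exprMn.
Qed.

Lemma enorm_eq0 (R : realType) (n : nat) (u : 'rV[R]_n) : enorm u = 0 -> u = 0.
Proof.
move=> u0; apply/rowP => i; rewrite mxE; apply/eqP; rewrite -sqrf_eq0.
have /eqP := sqr_enorm R n u; rewrite u0 expr0n eq_sym psumr_eq0 => [/allP|j _].
  by apply; rewrite mem_index_enum.
exact: sqr_ge0.
Qed.

(** Cauchy-Schwarz, read off from the squared norm of [B u - C v], which expands to [B (A B - C^2)];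
    here [A], [B] are the squared norms and [C] the inner product. *)
Lemma enorm_dot (R : realType) (n : nat) (u v : 'rV[R]_n) :
  \sum_(i < n) u 0 i * v 0 i <= enorm u * enorm v.
Proof.
have [/enorm_eq0 v0|v0] := eqVneq (enorm v) 0.
  by rewrite big1 ?mulr_ge0 ?enorm_ge0// => i _; rewrite v0 mxE mulr0.
have vgt0 : 0 < enorm v by rewrite lt0r v0 enorm_ge0.
have [C0|C0] := leP (\sum_(i < n) u 0 i * v 0 i) 0.
  by rewrite (le_trans C0)// mulr_ge0 ?enorm_ge0.
rewrite -ler_sqr ?nnegrE ?mulr_ge0 ?enorm_ge0 ?(ltW C0)// exprMn.
set C := \sum_(i < n) _ in C0 *; set B := enorm v ^+ 2; set A := enorm u ^+ 2.
have B0 : 0 < B by rewrite exprn_gt0.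
have : 0 <= \sum_(i < n) (B * u 0 i - C * v 0 i) ^+ 2.
  by rewrite sumr_ge0// => i _; rewrite sqr_ge0.
have -> : \sum_(i < n) (B * u 0 i - C * v 0 i) ^+ 2 = B * (A * B - C ^+ 2).
  rewrite (eq_bigr (fun i => B ^+ 2 * u 0 i ^+ 2
    + (- (2 * B * C)) * (u 0 i * v 0 i) + C ^+ 2 * v 0 i ^+ 2)); last first.
    by move=> i _; ring.
  by rewrite !big_split/= -!mulr_sumr -!sqr_enorm -/A -/B -/C; ring.
by rewrite pmulr_rge0// subr_ge0.
Qed.

Lemma ler_enormD (R : realType) (n : nat) (u v : 'rV[R]_n) :
  enorm (u + v) <= enorm u + enorm v.
Proof.
rewrite -ler_sqr ?nnegrE ?addr_ge0 ?enorm_ge0//.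
have -> : enorm (u + v) ^+ 2 =
    enorm u ^+ 2 + 2 * \sum_(i < n) u 0 i * v 0 i + enorm v ^+ 2.
  rewrite !sqr_enorm mulr_sumr -!big_split/=; apply: eq_bigr => i _.
  by rewrite mxE; ring.
by have := enorm_dot R n u v; lra.
Qed.

Lemma ler_enormB (R : realType) (n : nat) (u v : 'rV[R]_n) :
  enorm (u - v) <= enorm u + enorm v.
Proof.
apply: le_trans (ler_enormD _ _ _ _) _.
by rewrite -[- v]scaleN1r enormZ normrN1 mul1r.
Qed.

Lemma gradient_Qpen (R : realType) (n m : nat) (f : 'rV[R]_n -> R)
    (c : 'rV[R]_n -> 'rV[R]_m) (b : R) (x : 'rV[R]_n) :
  differentiable f x -> differentiable c x ->
  gradient (Qpen f c b) x = gradient f x + b *: (c x *m Jac c x).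
Proof.
move=> df dc; apply/rowP => j; rewrite !mxE.
set v := delta_mx 0 j.
have dfv := derivableP (@diff_derivable _ _ _ f x v df).
have dcv := @diff_derivable _ _ _ c x v dc.
have dci i : is_derive x v (fun y => c y 0 i) (jacobian c x j i).
  have -> : jacobian c x j i = 'D_v (fun y => c y 0 i) x.
    have := @deriveEjacobian _ _ _ c x v dc; rewrite -rowE derive_mx// => /matrixP/(_ 0 i).
    by rewrite !mxE.
  exact/derivableP/(derivable_mxP _ _ _).1.
have -> : Qpen f c b =
    f + (b / 2) \*: (\sum_(i < m) ((fun y => c y 0 i) ^+ 2)).
  apply/funext => y; rewrite /Qpen sqr_enorm /= !fctE fct_sumE.
  by congr (_ + _ * _); apply: eq_bigr.
rewrite derive_val; congr (_ + _).
rewrite /GRing.scale/= !mulr_sumr; apply: eq_bigr => i _.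
by rewrite !mxE /GRing.scale/= expr1; field.
Qed.

(** Both difference quotients are the same function of [h]. *)
Lemma is_derive_line (R : realType) (V W : normedModType R) (f : V -> W)
    (z v : V) (t : R) : derivable f (z + t *: v) v ->
  is_derive t 1 (fun s => f (z + s *: v)) ('D_v f (z + t *: v)).
Proof.
rewrite /derivable /derive => df.
suff E : (fun h : R => h^-1 *: (((fun s => f (z + s *: v)) \o shift t) (h *: 1)
      - f (z + t *: v))) =
    (fun h => h^-1 *: ((f \o shift (z + t *: v)) (h *: v) - f (z + t *: v))).
  by split; rewrite /derivable /derive E.
by apply/funext => h /=; rewrite [h *: 1]mulr1 scalerDl addrCA.
Qed.

(* The value a is not attained at a positive time: on the way to its first
   occurrence g stays below a, hence is constant. *)
Lemma stationary_below_le (R : realType) (g g' : R -> R) (a : R) :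
  (forall t : R, is_derive t 1 g (g' t)) -> g 0 < a ->
  (forall t, g t <= a -> g' t = 0) -> forall t, 0 <= t -> g t <= a.
Proof.
move=> dg g0 g'0 t t0; rewrite leNgt; apply/negP => gt.
have cg : continuous g.
  by move=> s; apply/differentiable_continuous/derivable1_diffP.
have cgi (u w : R) : {within `[u, w], continuous g}.
  exact: continuous_subspaceT.
(* The times in [[0, t]] where [g] equals [a]: nonempty by the intermediate value theorem and
   compact, so there is a first one, [s]. *)
pose E := `[0, t] `&` g @^-1` [set a].
have [] := @compact_EVT_min R R id E.
- have [||s s0t gs] := @IVT R g 0 t a t0; first exact: cgi.
    by rewrite ge_min le_max (ltW g0) (ltW gt) orbT.
  by exists s.
- apply: compact_closedI; first exact: segment_compact.
  by apply: preimage_closed; [move=> s _; exact: cg | exact: closed_eq].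
- by apply: continuous_subspaceT => ?.
move=> s /set_mem[/= s0t gs] smin.
have s0 : 0 < s.
  rewrite lt0r; move: s0t; rewrite in_itv/= => /andP[-> _]; rewrite andbT.
  by apply: contraTneq g0 => s0; rewrite -gs s0 ltxx.
(* Here [g s - g 0 = g' u * s]. If [g u <= a], this vanishes, against [g 0 < a]; if [g u > a], the
   value [a] is already taken before [u < s]. *)
have [u us] := MVT s0 (fun x _ => dg x) (cgi 0 s).
rewrite g'0 ?mul0r ?gs; first by lra.
rewrite leNgt; apply/negP => gu.
move: us; rewrite in_itv/= => /andP[u0 us].
have [|w] := IVT (ltW u0) (cgi 0 u) (v := a).
  by rewrite ge_min le_max (ltW g0) (ltW gu) orbT.
rewrite in_itv/= => /andP[w0 wu] gw.
suff /smin/= : w \in E by lra.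
by rewrite inE; split=> //=; move: s0t; rewrite !in_itv/=; lra.
Qed.

Lemma bounded_sublevel_nonstationary (R : realType) (n : nat)
    (f : 'rV[R]_n -> R) (a : R) (z : 'rV[R]_n) :
  (forall x, differentiable f x) -> bounded_set (sublevel f a) -> f z < a ->
  (forall x, sublevel f a x -> gradient f x = 0) -> n = 0%N.
Proof.
case: n f z => // n f z df /ex_strict_bound_gt0[M M0 bM] fz grad0.
set v : 'rV[R]_n.+1 := delta_mx 0 0.
have v0 : 0 < `|v|.
  rewrite normr_gt0; apply/eqP => /rowP/(_ 0); rewrite !mxE eqxx.
  by move/eqP; rewrite oner_eq0.
(* Chosen so that [t *: v] has norm [M + |z|], which puts [z + t *: v] outside the ball of radius
   [M]. *)
pose t := (M + `|z|) / `|v|.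
have t0 : 0 <= t by rewrite divr_ge0// addr_ge0 // ltW.
have : f (z + t *: v) <= a.
  apply: (@stationary_below_le R (fun s => f (z + s *: v))
    (fun s => 'D_v f (z + s *: v))) t0.
  - by move=> s; apply/is_derive_line/diff_derivable.
  - by rewrite scale0r addr0.
  - by move=> s /grad0 /rowP/(_ 0); rewrite !mxE.
move=> /bM /= ltM; suff : M <= `|z + t *: v| by rewrite leNgt ltM.
have := lerB_normD (t *: v) z; rewrite [z + _]addrC.
by apply: le_trans; rewrite normrZ ger0_norm// divfK ?gt_eqF// addrK.
Qed.

(* The row vector [c x *m Jac c x] is the transpose of J(x)^T c(x). *)
Theorem lemma4p3 (R : realType) (n m : nat) (hmn : (m <= n)%N)
    (f : 'rV[R]_n -> R) (c : 'rV[R]_n -> 'rV[R]_m)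
    (hf : forall x, differentiable f x)
    (hc : forall x, differentiable c x)
    (flow : R) (hflow : forall x, flow <= f x)
    (eps0 eps1 alpha beta0 : R)
    (heps0 : 0 < eps0) (heps1 : 0 < eps1)
    (halpha : 1 < alpha) (hbeta0 : 1 <= beta0)
    (x0 : 'rV[R]_n) (hx0 : enorm (c x0) <= eps0 / Num.sqrt 2)
    (r sigmamin : R) (hr : eps0 < r) (hsigma : 0 < sigmamin)
    (hJ : forall x, enorm (c x) <= r ->
      sigmamin * enorm (c x) <= enorm (c x *m Jac c x))
    (hbnd : bounded_set (sublevel f (2 * f x0 - flow)))
    (Lf0 : R) (hLf0 : 0 <= Lf0)
    (hgrad : forall x, sublevel f (2 * f x0 - flow) x ->
      enorm (gradient f x) <= Lf0)
    (taucap : R) (htaucap : eps1 <= taucap)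
    (x : nat -> 'rV[R]_n)
    (hx : QPM_iterates f c eps0 alpha beta0 (feas_tol c eps0 eps1 taucap) x0 x)
    (T : nat) (hT : (2 <= T)%N)
    (hinfeas : forall k : nat, (1 <= k <= T - 1)%N -> eps0 < enorm (c (x k))) :
  penalty alpha beta0 (T - 2) <
    Num.max ((Lf0 + eps1) / sigmamin) (4 * (f x0 - flow) / r) * eps0^-1.

Proof.
have hT1 : (T - 1 = (T - 2).+1)%N by case: T hT {hinfeas} => [|[|?]]//; rewrite !subSS !subn0.
(* Iteration [T - 2] is carried out because none of [x 1, ..., x (T - 2)] passes the stopping
   test. *)
have [] : QPM_step f c (feas_tol c eps0 eps1 taucap) x0
    (penalty alpha beta0 (T - 2)) (x (T - 2)%N) (x (T - 2).+1).
  apply: hx.2 => j /andP[j1 jT].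
  by apply: hinfeas; rewrite j1 hT1 (leq_trans jT).
have := hinfeas (T - 1)%N; rewrite leqnn andbT hT1 => /(_ isT).
set b := penalty _ _ _; set z := x _.+1 => hz.
have b1 : 1 <= b.
  by rewrite /b /penalty -[1]mul1r ler_pM ?exprn_ege1 ?(ltW halpha).
rewrite le_min => /andP[_]; rewrite /Qpen => hQ.
rewrite gradient_Qpen// => htau.
set C := enorm (c z) in hz hQ *.
have hc0 : enorm (c x0) ^+ 2 <= eps0 ^+ 2 / 2.
  rewrite (_ : eps0 ^+ 2 / 2 = (eps0 / Num.sqrt 2) ^+ 2).
    by rewrite ler_sqr ?nnegrE ?enorm_ge0// divr_ge0// ltW.
  by rewrite expr_div_n sqr_sqrtr.
have C0 : eps0 ^+ 2 < C ^+ 2 by rewrite ltr_sqr ?nnegrE; lra.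
have hfl := hflow z.
(* The penalty at [x0] is at most [b eps0^2 / 4 < b C^2 / 4], which absorbs half of the penalty
   [b C^2 / 2] at [z]. *)
have hbC : f z + b * C ^+ 2 / 4 < f x0 by nra.
have hfz : f z < f x0 by nra.
have hz_sub : sublevel f (2 * f x0 - flow) z by rewrite /sublevel/=; lra.
(* At an infeasible point [eps1 < eps1 / eps0 * C], so the linear term bounds both arguments of the
   maximum. *)
have htol : feas_tol c eps0 eps1 taucap z <= eps1 / eps0 * C.
  rewrite /feas_tol ge_max ge_min lexx orbT andbT.
  by rewrite mulrAC ler_pdivlMr// ler_pM2l// ltW.
have r0 : 0 < r by lra.
rewrite ltNge; apply/negP; rewrite ler_pdivrMr// ge_max => /andP[].
rewrite !ler_pdivrMr// => hL hR.
have hCr : C <= r.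
  (* By [hbC] and [hR], [b C^2 < 4 (f x0 - flow) <= b eps0 r]; then [eps0 < r] gives [C^2 < r^2]. *)
  have Cer : C ^+ 2 < eps0 * r.
    by rewrite -(@ltr_pM2l _ b); [rewrite mulrA; lra | lra].
  rewrite -ler_sqr ?nnegrE; [|lra..].
  by nra.
have hJz := hJ _ hCr.
have hmain : b * (sigmamin * C) <= eps1 / eps0 * C + enorm (gradient f z).
  apply: (@le_trans _ _ (b * enorm (c z *m Jac c z))).
    by rewrite ler_pM2l//; lra.
  rewrite -[X in X * _]ger0_norm; last lra.
  rewrite -enormZ -[_ *: _](addKr (gradient f z)) addrC.
  by apply: le_trans (ler_enormB _ _ _ _) _; rewrite lerD2r (le_trans htau).
have hg := hgrad _ hz_sub.
have hE : eps1 / eps0 * eps0 = eps1 by rewrite divfK// gt_eqF.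
(* [hL] gives [b sigmamin - eps1 / eps0 >= Lf0 / eps0]. When this is positive, multiplying by
   [C > eps0] exceeds [Lf0], against [hmain]; for [Lf0 = 0] strictness is lost. *)
have [L0|L0] := eqVneq Lf0 0; last first.
  have Lgt0 : 0 < Lf0 by rewrite lt0r L0.
  by nra.
have n0 : n = 0%N.
  apply: (bounded_sublevel_nonstationary R n f _ z hf hbnd); first by lra.
  move=> y /hgrad; rewrite L0 => hy; apply: enorm_eq0.
  by apply/eqP; rewrite eq_le hy enorm_ge0.
have m0 : m = 0%N by apply/eqP; rewrite -leqn0 -n0.
have : C = 0 by subst m; rewrite /C /enorm big_ord0 sqrtr0.
by lra.
Qed.
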